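(* Let $K$ be an algebraically closed field, let $\mathcal{V}$ be the category of finite-dimensional vector spaces over $K$, and let $F:\mathcal{V}\to\mathcal{V}$ be a self-adjoint functor. Then $F$ is naturally isomorphic to the functor $\operatorname{Hom}_{\mathcal{V}}(F(K),-)$ and to the functor $-\otimes_K F(K)$.
   Context: A functor $F:\mathcal{C}\to\mathcal{C}$ is called self-adjoint if it is left (hence also right) adjoint to itself, i.e. if there is a bijection $\varphi_{X,Y}:\operatorname{Hom}_{\mathcal{C}}(F(X),Y)\to\operatorname{Hom}_{\mathcal{C}}(X,F(Y))$ for all objects $X,Y\in\mathcal{C}$, natural in $X$ and $Y$.
   Formalization: The functor F is additionally assumed K-linear on Hom spaces; for a bare functor the claim fails (complex conjugation of matrices over the complex numbers is self-adjoint), and K-linearity is necessary for the conclusion. *)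

(* Defs.v *)
From HB Require Import structures.
From mathcomp Require Import all_boot all_algebra.
From mathcomp Require Import sesquilinear.

Set Implicit Arguments.
Unset Strict Implicit.
Unset Printing Implicit Defensive.

Import GRing.Theory.
Local Open Scope ring_scope.

Record category := Category {
  ob :> Type;
  hom : ob -> ob -> Type;
  idm : forall X, hom X X;
  comp : forall X Y Z, hom Y Z -> hom X Y -> hom X Z;
  comp1m : forall X Y (f : hom X Y), comp (idm Y) f = f;
  compm1 : forall X Y (f : hom X Y), comp f (idm X) = f;
  compA : forall X Y Z T (h : hom Z T) (g : hom Y Z) (f : hom X Y),
    comp h (comp g f) = comp (comp h g) f
}.
Arguments idm {c} X.
Arguments comp {c X Y Z} g f : rename.

Record functor (C D : category) := Functor {
  fobj :> C -> D;
  fmap : forall X Y : C, hom X Y -> hom (fobj X) (fobj Y);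
  fmap1 : forall X : C, fmap (idm X) = idm (fobj X);
  fmap_comp : forall (X Y Z : C) (g : hom Y Z) (f : hom X Y),
    fmap (comp g f) = comp (fmap g) (fmap f)
}.
Arguments fmap {C D} F {X Y} f : rename.

Definition self_adjoint (C : category) (F : functor C C) : Prop :=
  exists phi : forall X Y : C, hom (F X) Y -> hom X (F Y),
    [/\ forall X Y : C, bijective (phi X Y),
        forall (X X' Y : C) (f : hom X' X) (g : hom (F X) Y),
          phi X' Y (comp g (fmap F f)) = comp (phi X Y g) f
      & forall (X Y Y' : C) (h : hom Y Y') (g : hom (F X) Y),
          phi X Y' (comp h g) = comp (fmap F h) (phi X Y g)].

Definition isomorphism (C : category) (X Y : C) (f : hom X Y) : Prop :=
  exists g : hom Y X, comp g f = idm X /\ comp f g = idm Y.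

Definition naturally_isomorphic (C D : category) (F G : functor C D) : Prop :=
  exists eta : forall X : C, hom (F X) (G X),
    (forall X : C, isomorphism (eta X)) /\
    (forall (X Y : C) (f : hom X Y),
       comp (eta Y) (fmap F f) = comp (fmap G f) (eta X)).

Definition fdVect (K : fieldType) : category :=
  @Category (vectType K) (fun U V => 'Hom(U, V))
    (fun U => \1%VF) (fun U V W g f => (g \o f)%VF)
    (fun U V f => comp_lfun1l f) (fun U V f => comp_lfun1r f)
    (fun U V W T h g f => comp_lfunA h g f).

(* A functor here need not be additive or K-linear. K-linearity does not follow
   from self-adjointness, which only involves bijections of sets: conjugating
   the matrices of linear maps is a self-adjoint endofunctor of the category of
   finite-dimensional complex vector spaces. *)
Definition klinear (K : fieldType) (F : functor (fdVect K) (fdVect K)) : Prop :=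
  forall U V : vectType K,
    linear (fmap F : 'Hom(U, V) -> 'Hom((F U : vectType K), (F V : vectType K))).

Section HomFunctor.
Variables (K : fieldType) (W : vectType K).

Definition postcomp (U V : vectType K) (f : 'Hom(U, V)) (g : 'Hom(W, U)) :
  'Hom(W, V) := (f \o g)%VF.

Fact postcomp_linear (U V : vectType K) (f : 'Hom(U, V)) : linear (postcomp f).
Proof. by move=> a g h; rewrite /postcomp comp_lfunDr comp_lfunZr. Qed.

HB.instance Definition _ (U V : vectType K) (f : 'Hom(U, V)) :=
  GRing.isLinear.Build K 'Hom(W, U) 'Hom(W, V) _ (postcomp f)
    (@postcomp_linear U V f).

Fact hom_functor1 (U : vectType K) :
  linfun (postcomp (\1%VF : 'Hom(U, U))) = \1%VF.
Proof. by apply/lfunP=> g; rewrite lfunE /= id_lfunE /postcomp comp_lfun1l. Qed.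

Fact hom_functor_comp (U V X : vectType K) (g : 'Hom(V, X)) (f : 'Hom(U, V)) :
  linfun (postcomp (g \o f)%VF) = (linfun (postcomp g) \o linfun (postcomp f))%VF.
Proof.
by apply/lfunP=> h; rewrite comp_lfunE !lfunE /= /postcomp comp_lfunA.
Qed.

Definition hom_functor : functor (fdVect K) (fdVect K) :=
  @Functor (fdVect K) (fdVect K) (fun V => 'Hom(W, V) : vectType K)
    (fun U V f => linfun (postcomp f)) hom_functor1 hom_functor_comp.

End HomFunctor.

Section Tensor.
Variable K : fieldType.
Implicit Types U V W Z : vectType K.

(* The tensor product of V and W is realized as a space of matrices, the pure
   tensor of v and w having as entries the products of the coordinates of v and
   w; tens_universal shows that this is a tensor product. *)
Definition tens V W : vectType K := 'M[K]_(\dim {:V}, \dim {:W}).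

Definition pure V W (v : V) (w : W) : tens V W :=
  \matrix_(i, j) (coord (vbasis {:V}) i v * coord (vbasis {:W}) j w).

Fact pure_bilinear V W : bilinear_for *:%R *:%R (@pure V W).
Proof.
split=> [w a v v'|v a w w']; apply/matrixP=> i j; rewrite !mxE linearP /=.
  by rewrite mulrDl mulrA.
by rewrite mulrDr mulrCA.
Qed.

HB.instance Definition _ V W :=
  bilinear_isBilinear.Build K V W (tens V W) *:%R *:%R (@pure V W)
    (@pure_bilinear V W).

Definition tens_ext V W Z (b : V -> W -> Z) (M : tens V W) : Z :=
  \sum_i \sum_j M i j *: b (vbasis {:V})`_i (vbasis {:W})`_j.

Fact tens_ext_linear V W Z (b : V -> W -> Z) : linear (tens_ext b).
Proof.
move=> a M N; rewrite /tens_ext scaler_sumr -big_split; apply: eq_bigr => i _ /=.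
rewrite scaler_sumr -big_split; apply: eq_bigr => j _ /=.
by rewrite !mxE scalerDl scalerA.
Qed.

HB.instance Definition _ V W Z (b : V -> W -> Z) :=
  GRing.isLinear.Build K (tens V W) Z _ (tens_ext b) (tens_ext_linear b).

Definition tens_lift V W Z (b : V -> W -> Z) : 'Hom(tens V W, Z) :=
  linfun (tens_ext b).

Lemma tens_lift_pure V W Z (b : {bilinear V -> W -> Z}) v w :
  tens_lift b (pure v w) = b v w.
Proof.
rewrite lfunE /= /tens_ext.
rewrite {2}(coord_vbasis (memvf v)) {2}(coord_vbasis (memvf w)).
rewrite linear_sumlz; apply: eq_bigr => i _.
rewrite linearZl_LR linear_sumr scaler_sumr; apply: eq_bigr => j _.
by rewrite linearZr_LR scalerA mxE.
Qed.

Lemma tens_lfunP V W Z (h h' : 'Hom(tens V W, Z)) :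
  (forall v w, h (pure v w) = h' (pure v w)) -> h = h'.
Proof.
move=> eqh; apply/lfunP=> M; rewrite (matrix_sum_delta M) !linear_sum.
apply: eq_bigr => i _; rewrite !linear_sum; apply: eq_bigr => j _.
rewrite !linearZ; congr (_ *: _).
suff -> : delta_mx i j = pure (vbasis {:V})`_i (vbasis {:W})`_j by exact: eqh.
apply/matrixP=> k l; rewrite !mxE.
by rewrite !coord_free ?(basis_free (vbasisP _)) // -natrM mulnb (eq_sym i) (eq_sym j).
Qed.

Lemma tens_universal V W Z (b : {bilinear V -> W -> Z}) :
  exists! h : 'Hom(tens V W, Z), forall v w, h (pure v w) = b v w.
Proof.
exists (tens_lift b); split=> [|h hP]; first exact: tens_lift_pure.
by apply: tens_lfunP => v w; rewrite tens_lift_pure hP.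
Qed.

Definition tens_map U V W Z (f : 'Hom(U, V)) (g : 'Hom(W, Z)) :
  'Hom(tens U W, tens V Z) := tens_lift (fun u w => pure (f u) (g w)).

Lemma tens_map_pure U V W Z (f : 'Hom(U, V)) (g : 'Hom(W, Z)) u w :
  tens_map f g (pure u w) = pure (f u) (g w).
Proof.
have bP : bilinear_for *:%R *:%R (fun u w => pure (f u) (g w)).
  by split=> [x a y z|x a y z]; rewrite linearP ?linearPl ?linearPr.
pose B := bilinear_isBilinear.Build K U W (tens V Z) *:%R *:%R _ bP.
pose b : {bilinear U -> W -> tens V Z} := HB.pack (fun u w => pure (f u) (g w)) B.
exact: (tens_lift_pure b).
Qed.

Variable W : vectType K.

Fact tens_functor1 V : tens_map (\1%VF : 'Hom(V, V)) (\1%VF : 'Hom(W, W)) = \1%VF.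
Proof. by apply: tens_lfunP => v w; rewrite tens_map_pure !id_lfunE. Qed.

Fact tens_functor_comp U V Z (g : 'Hom(V, Z)) (f : 'Hom(U, V)) :
  tens_map (g \o f)%VF (\1%VF : 'Hom(W, W)) =
  (tens_map g \1%VF \o tens_map f \1%VF)%VF.
Proof.
by apply: tens_lfunP => v w; rewrite comp_lfunE !tens_map_pure comp_lfunE !id_lfunE.
Qed.

Definition tens_functor : functor (fdVect K) (fdVect K) :=
  @Functor (fdVect K) (fdVect K) (fun V => tens V W)
    (fun U V f => tens_map f \1%VF) tens_functor1 tens_functor_comp.

End Tensor.

(* Main.v *)
(** A [K]-linear functor commutes with the decomposition of the identity of [V]
    as the sum of the [e_i ε_i], for a basis [e] with dual basis [ε], so that [v ⊗ x |-> F(v) x],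
    where [v] is seen as a map from [K] to [V], has the inverse
    [y |-> \sum_i e_i ⊗ F(ε_i) y]. If [phi] is an adjunction of [F] with itself
    and [eta := phi (id_(F K)) : K -> F (F K)], naturality gives
    [phi g = F(g) eta], and so [g |-> F(g) (eta 1)] is a linear bijection
    from [Hom(F K, V)] to [F V], natural in [V]. *)

Require Import Defs.
From mathcomp Require Import all_boot all_algebra.
From HB Require Import structures.
From mathcomp Require Import sesquilinear.

Set Implicit Arguments.
Unset Strict Implicit.
Unset Printing Implicit Defensive.

Import GRing.Theory.
Local Open Scope ring_scope.

Section NaturalIsomorphism.
Variables (K : fieldType) (F G : functor (fdVect K) (fdVect K)).

(** The transformations built below are most naturally maps into [F], hence the direction of
    [theta]. Injectivity makes the linear inverse a left inverse, surjectivity makes it a right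
    inverse too, and naturality passes to inverses. *)
Lemma naturally_isomorphic_of_bij
    (theta : forall U : vectType K, 'Hom((G U : vectType K), (F U : vectType K))) :
  (forall U, bijective (theta U)) ->
  (forall (U V : vectType K) (f : 'Hom(U, V)) x,
     theta V ((fmap G f : 'Hom(_, _)) x) = (fmap F f : 'Hom(_, _)) (theta U x)) ->
  naturally_isomorphic F G.
Proof.
move=> theta_bij theta_nat.
have thetaK U : cancel (theta U) (theta U)^-1%VF.
  by apply: lker0_lfunK; apply/lker0P/bij_inj/theta_bij.
have thetaVK U : cancel (theta U)^-1%VF (theta U).
  by move=> y; have [g _ gK] := theta_bij U; rewrite -(gK y) thetaK.
exists (fun U => (theta U)^-1%VF); split=> [U|U V f].
  exists (theta U); split; apply/lfunP=> x; rewrite comp_lfunE id_lfunE;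
    [exact: thetaVK | exact: thetaK].
apply/lfunP=> x; rewrite !comp_lfunE; apply: (can_inj (thetaK V)).
by rewrite thetaVK theta_nat thetaVK.
Qed.

End NaturalIsomorphism.

Section ScalarMap.
Variables (K : fieldType) (V : vectType K).

Definition scalar_map_fun (v : V) (a : K^o) : V := a *: v.

Fact scalar_map_fun_linear v : linear (scalar_map_fun v).
Proof. by move=> a b c; rewrite /scalar_map_fun scalerDl scalerA. Qed.

HB.instance Definition _ v :=
  GRing.isLinear.Build K K^o V _ (scalar_map_fun v) (@scalar_map_fun_linear v).

Definition scalar_map (v : V) : 'Hom(K^o, V) := linfun (scalar_map_fun v).

Lemma scalar_mapE v a : scalar_map v a = a *: v.
Proof. by rewrite lfunE. Qed.

Lemma scalar_map_linear : linear scalar_map.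
Proof.
move=> a u v; apply/lfunP=> b.
by rewrite add_lfunE scale_lfunE !scalar_mapE scalerDr !scalerA mulrC.
Qed.

Definition dual_basis (i : 'I_(\dim {:V})) : 'Hom(V, K^o) :=
  linfun (coord (vbasis {:V}) i : V -> K^o).

Lemma dual_basisE i v : dual_basis i v = coord (vbasis {:V}) i v.
Proof. by rewrite lfunE. Qed.

Lemma sum_dual_basis :
  \sum_(i < \dim {:V}) (scalar_map (vbasis {:V})`_i \o dual_basis i)%VF = \1%VF.
Proof.
apply/lfunP=> v; rewrite sum_lfunE id_lfunE {2}(coord_vbasis (memvf v)).
by apply: eq_bigr => i _; rewrite comp_lfunE scalar_mapE dual_basisE.
Qed.

End ScalarMap.

(** Naturality of the identification of [V] with Hom(K, V) given by [scalar_map]. *)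
Lemma comp_scalar_map (K : fieldType) (U V : vectType K) (f : 'Hom(U, V)) u :
  (f \o scalar_map u)%VF = scalar_map (f u).
Proof. by apply/lfunP=> a; rewrite comp_lfunE !scalar_mapE linearZ. Qed.

Section LinearFunctor.
Variables (K : fieldType) (F : functor (fdVect K) (fdVect K)).
Hypothesis F_lin : klinear F.

(** [fmap F] retyped between spaces of linear maps, so that the linearity in [F_lin] can be attached
    to it. *)
Let Fm (U V : vectType K) (f : 'Hom(U, V)) :
  'Hom((F U : vectType K), (F V : vectType K)) := fmap F f.

HB.instance Definition _ (U V : vectType K) :=
  GRing.isLinear.Build K 'Hom(U, V) 'Hom((F U : vectType K), (F V : vectType K))
    _ (@Fm U V) (@F_lin U V).

Let Fm1 (U : vectType K) : Fm (\1%VF : 'Hom(U, U)) = \1%VF.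
Proof. exact: (@fmap1 _ _ F U). Qed.

Let Fm_comp (U V W : vectType K) (g : 'Hom(V, W)) (f : 'Hom(U, V)) x :
  Fm (g \o f)%VF x = Fm g (Fm f x).
Proof.
by rewrite -comp_lfunE; congr (fun_of_lfun _ x); exact: (@fmap_comp _ _ F).
Qed.

Let FK : vectType K := F (K^o : vectType K).

Definition tens_eval_fun (V : vectType K) (v : V) (x : FK) : (F V : vectType K) :=
  Fm (scalar_map v) x.

(** Linearity in [v] comes from the K-linearity of [F] on morphisms, linearity in [x] from
    [Fm (scalar_map v)] being a linear map. *)
Fact tens_eval_fun_bilinear (V : vectType K) :
  bilinear_for *:%R *:%R (@tens_eval_fun V).
Proof.
split=> [x a u v|v a x y]; last by rewrite /tens_eval_fun linearP.
by rewrite /tens_eval_fun scalar_map_linear linearP add_lfunE scale_lfunE.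
Qed.

HB.instance Definition _ (V : vectType K) :=
  bilinear_isBilinear.Build K V FK (F V : vectType K) *:%R *:%R (@tens_eval_fun V)
    (@tens_eval_fun_bilinear V).

Definition tens_eval (V : vectType K) : 'Hom(tens V FK, (F V : vectType K)) :=
  tens_lift (@tens_eval_fun V).

Lemma tens_eval_pure (V : vectType K) (v : V) x :
  tens_eval V (pure v x) = Fm (scalar_map v) x.
Proof. exact: tens_lift_pure. Qed.

(** On a pure tensor of [u] and [x] both sides equal [Fm (scalar_map (f u)) x], by functoriality. *)
Lemma tens_eval_nat (U V : vectType K) (f : 'Hom(U, V)) z :
  tens_eval V (tens_map f \1%VF z) = Fm f (tens_eval U z).
Proof.
rewrite -!comp_lfunE; congr (fun_of_lfun _ z); apply: tens_lfunP => u x.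
rewrite !comp_lfunE tens_map_pure !tens_eval_pure id_lfunE.
by rewrite -Fm_comp comp_scalar_map.
Qed.

Definition tens_coeval_fun (V : vectType K) (y : (F V : vectType K)) : tens V FK :=
  \sum_(i < \dim {:V}) pure (vbasis {:V})`_i (Fm (dual_basis i) y).

Fact tens_coeval_fun_linear (V : vectType K) : linear (@tens_coeval_fun V).
Proof.
move=> a x y; rewrite /tens_coeval_fun scaler_sumr -big_split.
by apply: eq_bigr => i _; rewrite linearP linearPr.
Qed.

HB.instance Definition _ (V : vectType K) :=
  GRing.isLinear.Build K (F V : vectType K) (tens V FK) _ (@tens_coeval_fun V)
    (@tens_coeval_fun_linear V).

Lemma tens_eval_bij (V : vectType K) : bijective (tens_eval V).
Proof.
exists (@tens_coeval_fun V) => [z|y]; last first.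
  (* Write [y] as [Fm \1 y], decompose the identity, and let the linear [Fm] pass through the
     sum. *)
  rewrite linear_sum -[RHS]id_lfunE -Fm1 -sum_dual_basis linear_sum sum_lfunE.
  apply: eq_bigr => i _; apply: etrans (tens_eval_pure _ _) _.
  by rewrite -Fm_comp.
pose c := linfun (@tens_coeval_fun V).
suff /lfunP/(_ z) : (c \o tens_eval V)%VF = \1%VF.
  by rewrite comp_lfunE id_lfunE lfunE.
apply: tens_lfunP => v x; rewrite comp_lfunE id_lfunE lfunE tens_eval_pure.
rewrite {2}(coord_vbasis (memvf v)) linear_sumlz; apply: eq_bigr => i _.
(* The dual basis vector applied to [v] is a coordinate of [v]; that scalar moves across the tensor
   onto [x]. *)
rewrite -Fm_comp comp_scalar_map dual_basisE linearZl_LR -linearZr_LR.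
congr pure; set a := coord _ _ _.
(* As an endomorphism of [K^o], [scalar_map a] is [a] times the identity, so [Fm] sends it to [a]
   times the identity. *)
suff -> : scalar_map (a : K^o) = a *: \1%VF.
  by rewrite linearZ /= [Fm _]Fm1 scale_lfunE id_lfunE.
by apply/lfunP=> b; rewrite scalar_mapE scale_lfunE id_lfunE; apply: mulrC.
Qed.

Lemma klinear_tens_functor : naturally_isomorphic F (tens_functor FK).
Proof.
apply: (@naturally_isomorphic_of_bij _ F (tens_functor FK) tens_eval).
  exact: tens_eval_bij.
exact: tens_eval_nat.
Qed.

(** The transformation from Hom(W, -) to [F] that the Yoneda lemma attaches to [u]. *)
Definition hom_eval_fun (W V : vectType K) (u : (F W : vectType K))
  (g : 'Hom(W, V)) : (F V : vectType K) := Fm g u.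

Fact hom_eval_fun_linear (W V : vectType K) u : linear (@hom_eval_fun W V u).
Proof. by move=> a f g; rewrite /hom_eval_fun linearP add_lfunE scale_lfunE. Qed.

HB.instance Definition _ (W V : vectType K) u :=
  GRing.isLinear.Build K 'Hom(W, V) (F V : vectType K) _ (@hom_eval_fun W V u)
    (@hom_eval_fun_linear W V u).

Lemma self_adjoint_hom_functor :
  self_adjoint F -> naturally_isomorphic F (hom_functor FK).
Proof.
case=> phi [phi_bij _ phi_nat].
pose eta : 'Hom(K^o, (F FK : vectType K)) :=
  phi (K^o : vectType K) FK (\1%VF : 'Hom(FK, FK)).
pose theta (V : vectType K) := linfun (@hom_eval_fun FK V (eta 1)).
have thetaE V g : theta V g = Fm g (eta 1) by rewrite lfunE.
have phiE (V : vectType K) (g : 'Hom(FK, V)) :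
    phi (K^o : vectType K) V g = scalar_map (theta V g).
  have -> : phi (K^o : vectType K) V g = (Fm g \o eta)%VF.
    by rewrite -[g in LHS](comp_lfun1r g); apply: phi_nat.
  rewrite thetaE -comp_scalar_map; congr (_ \o _)%VF.
  (* A linear map out of [K^o] is determined by its value at 1. *)
  by apply/lfunP=> a; rewrite scalar_mapE -linearZ -[a%:A]/(a * 1) mulr1.
apply: (@naturally_isomorphic_of_bij _ F (hom_functor FK) theta) => [V|U V f g].
  have [psi phiK psiK] := phi_bij (K^o : vectType K) V.
  (* By [phiE], [phi] is [theta V] followed by [scalar_map], and evaluation at 1 undoes the
     latter. *)
  exists (fun y => psi (scalar_map y)) => [g|y]; first by rewrite -phiE phiK.
  by rewrite -[LHS]scale1r -scalar_mapE -phiE psiK scalar_mapE scale1r.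
by rewrite !thetaE lfunE; apply: Fm_comp.
Qed.

End LinearFunctor.

Theorem theorem4 (K : closedFieldType) (F : functor (fdVect K) (fdVect K)) :
  klinear F -> self_adjoint F ->
  naturally_isomorphic F (hom_functor (F (K^o : vectType K))) /\
  naturally_isomorphic F (tens_functor (F (K^o : vectType K))).
Proof.
move=> F_lin F_adj; split; first exact: self_adjoint_hom_functor.
exact: klinear_tens_functor.
Qed.
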